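(* For every positive integer $n$, every integer $k$ with $0\le k\le n$, and all increasing events $A,B\subset\{0,1\}^n$, $$P_{k,n}(A\,\square\,B)\le P_{k,n}(A)\,P_{k,n}(B).$$
   Context: Let $\Omega=\{0,1\}^n$ and $[n]=\{1,\dots,n\}$. For $\omega\in\Omega$ and $S\subset[n]$, write $\omega_S=(\omega_i)_{i\in S}$ and $[\omega]_S=\{\alpha\in\Omega:\alpha_S=\omega_S\}$. For $A,B\subset\Omega$, define $$A\,\square\,B=\{\omega\in\Omega:\ \text{there exist disjoint } K,L\subset[n]\text{ such that }[\omega]_K\subset A\text{ and }[\omega]_L\subset B\}.$$ For $\omega,\omega'\in\Omega$, write $\omega'\ge\omega$ if $\omega'_i\ge\omega_i$ for all $i\in[n]$. An event $A\subset\Omega$ is increasing if $\omega'\in A$ whenever $\omega\in A$ and $\omega'\ge\omega$. Let $\Omega_{k,n}$ be the set of all $\omega\in\Omega$ with exactly $k$ coordinates equal to $1$. The $k$-out-of-$n$ measure $P_{k,n}$ is the probability measure on $\Omega$ that assigns equal probability to all $\omega\in\Omega_{k,n}$ and probability $0$ to all other elements of $\Omega$. *)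

(* Defs.v *)
From mathcomp Require Import all_boot all_order all_algebra.

Set Implicit Arguments.
Unset Strict Implicit.
Unset Printing Implicit Defensive.

Import Order.TTheory GRing.Theory Num.Theory.

(* The coordinates [n] = {1, ..., n} are indexed from 0, by 'I_n. *)
Definition config (n : nat) := {ffun 'I_n -> bool}.

Definition cylinder (n : nat) (w : config n) (S : {set 'I_n}) :
    {set config n} :=
  [set a : config n | [forall i in S, a i == w i]].

Definition box (n : nat) (A B : {set config n}) : {set config n} :=
  [set w : config n |
    [exists K : {set 'I_n}, exists L : {set 'I_n},
      [&& [disjoint K & L], cylinder w K \subset A & cylinder w L \subset B]]].

Definition config_le (n : nat) (w w' : config n) : Prop :=
  forall i : 'I_n, (w i <= w' i)%N.

Definition increasing (n : nat) (A : {set config n}) : Prop :=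
  forall w w' : config n, w \in A -> config_le w w' -> w' \in A.

Definition Omega (k n : nat) : {set config n} :=
  [set w : config n | #|[set i : 'I_n | w i]| == k].

Definition kn_mass (R : realFieldType) (k n : nat) (w : config n) : R :=
  (if w \in Omega k n then (#|Omega k n|%:R)^-1 else 0)%R.

(* Meaningful only for k <= n: otherwise Omega k n is empty and P is 0. *)
Definition P (R : realFieldType) (k n : nat) (A : {set config n}) : R :=
  (\sum_(w in A) kn_mass R k w)%R.

(* Main.v *)
Require Import Defs.
From mathcomp Require Import all_boot all_order all_fingroup all_algebra.
Local Open Scope ring_scope.

(** Multiply by the square of the number of configurations with k ones: the claim
    compares the number of pairs (a, b) of such configurations with a in the box
    of A and B with the number of pairs with a in A and b in B.

    Fix such a pair. As a and b have equally many ones, the coordinates where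
    only a is 1 can be matched with those where only b is 1. Choosing one
    coordinate from each matched pair, and leaving the other coordinates as they
    are, gives a family of configurations indexed by a cube, in which a and b, and
    more generally any choice and the opposite one, are antipodal. On this cube A
    and B become arbitrary events, and disjoint occurrence is preserved
    ([box_preim]); here it matters that A and B are increasing, since witnesses may
    then be taken among the ones, at most one of which lies in each matched pair.
    So the claim, averaged over the cube, follows from Reimer's inequality
    #|box A B| <= #|{z in A | flip z in B}| for arbitrary events of the cube
    ([reimer]). All points of the cube are related to (a, b) by permutations of
    the coordinates, so averaging over the symmetric group as well makes the
    weights uniform ([swap_average], [box_Omega]).

    Reimer's inequality is proved by linear algebra. Let x in the box of A and B
    have the witnesses K x for A and the complement of K x for B. In the n-th
    tensor power of the plane, attach to x the tensor of a_(x_i) for i in K x and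
    b_(x_i) for the other i, where (a_0, b_0) and (a_1, b_1) are two orthogonal
    bases. These vectors are linearly independent, because they are so modulo 2
    ([butterfly_free2]). They are combinations of the tensors of a_(y_i) with y in
    A, and are orthogonal to those with flip y outside B; so their Gram
    matrix, which is nonsingular, factors through the set of y in A with flip y in
    B ([butterfly_card]). *)

Set Implicit Arguments.
Unset Strict Implicit.
Unset Printing Implicit Defensive.

Import Order.TTheory GRing.Theory Num.Theory.

(** * Reimer's inequality for arbitrary events *)

Definition flip n (x : config n) : config n := [ffun i => ~~ x i].

(** Two orthogonal bases of the plane, with z as coordinate index:
    a_0 = (1, 0) and b_0 = (0, 1) are orthogonal, and so are a_1 = (1, 1) and
    b_1 = (1, -1). The two bases differ by an angle of 45 degrees; modulo 2,
    a_1 and b_1 coincide, which is exploited in [butterfly_free2]. *)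
Definition avec (R : comNzRingType) (x z : bool) : R := if x then 1 else (~~ z)%:R.
Definition bvec (R : comNzRingType) (x z : bool) : R :=
  if x then (-1) ^+ z else z%:R.

Lemma abvec_orth (R : comNzRingType) x :
  \sum_z avec R x z * bvec R x z = 0.
Proof.
case: x; rewrite big_bool /= /avec /bvec /=.
  by rewrite !mul1r expr1 expr0 addNr.
by rewrite mul0r mulr0 addr0.
Qed.

(** Coordinates of b_x in the basis (a_0, a_1): b_0 = a_1 - a_0 and
    b_1 = 2 a_0 - a_1. *)
Definition bcoef (R : comNzRingType) (x y : bool) : R :=
  if x then (if y then -1 else 2) else (if y then 1 else -1).

Lemma bvec_avec (R : comNzRingType) x z :
  bvec R x z = \sum_y bcoef R x y * avec R y z.
Proof.
rewrite big_bool /bcoef /avec /bvec.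
case: x; case: z => /=; rewrite ?mul1r ?mulr1 ?mulr0 ?addr0 ?subrr //.
by rewrite expr0 addrC addrK.
Qed.

(** If u S is the combination of the rows given by a u in the kernel, then u S is
    orthogonal to itself, hence zero over an ordered field. *)
Lemma gram_free (R : realFieldType) m p (S : 'M[R]_(m, p)) :
  row_free S -> row_free (S *m S^T).
Proof.
move=> freeS; apply/inj_row_free => u uS.
apply: (row_free_inj freeS); rewrite mul0mx; set w := u *m S.
have: (w *m w^T) 0 0 = 0 by rewrite trmx_mul mulmxA -(mulmxA u) uS mul0mx mxE.
rewrite mxE => /eqP; rewrite psumr_eq0 => [/allP w0|j _]; last first.
  by rewrite [w^T _ _]mxE -expr2 sqr_ge0.
apply/rowP => j; have := w0 j (mem_index_enum j).
by rewrite /= [w^T _ _]mxE mulf_eq0 orbb => /eqP->; rewrite [RHS]mxE.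
Qed.

Section Butterfly.
Variables (n : nat) (K : config n -> {set 'I_n}).
Implicit Types x y z : config n.

Definition factor (R : comNzRingType) x (i : 'I_n) (b : bool) : R :=
  if i \in K x then avec R (x i) b else bvec R (x i) b.

(** A vector of the 2^n-dimensional space of functions on the cube: the pure
    tensor that has a_(x_i) on the coordinates i in K x and b_(x_i) on the
    others. *)
Definition butterfly (R : comNzRingType) x z : R := \prod_i factor R x i (z i).

(** As y varies, these pure tensors form a basis of the same space. *)
Definition avecs (R : comNzRingType) y z : R := \prod_i avec R (y i) (z i).

(** Coordinates of the vector of x in the basis of the [avecs]: the products of
    the coordinates of its factors in the basis (a_0, a_1). *)
Definition bfly_coef (R : comNzRingType) x y : R :=
  \prod_i (if i \in K x then (y i == x i)%:R else bcoef R (x i) (y i)).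

Lemma butterfly_avecs (R : comNzRingType) x z :
  butterfly R x z = \sum_y bfly_coef R x y * avecs R y z.
Proof.
rewrite /butterfly.
under [RHS]eq_bigr do rewrite -big_split /=.
rewrite -(bigA_distr_bigA (fun i b => (if i \in K x then (b == x i)%:R
    else bcoef R (x i) b) * avec R b (z i))).
apply: eq_bigr => i _; rewrite /factor; case: ifP => _; last exact: bvec_avec.
by rewrite (bigD1 (x i)) //= eqxx mul1r big1 ?addr0 // => b /negPf->; rewrite mul0r.
Qed.

(** On K x the factor a_(x_i) is already a basis vector, so only those y that
    agree with x there contribute. *)
Lemma bfly_coef0 (R : comNzRingType) x y :
  y \notin cylinder x (K x) -> bfly_coef R x y = 0.
Proof.
rewrite inE => /forall_inPn[i iK /negPf yxi].
by rewrite /bfly_coef (bigD1 i) //= iK yxi mul0r.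
Qed.

Definition bfly_dot (R : comNzRingType) x y : R :=
  \sum_z butterfly R x z * avecs R y z.

(** If y_i = x_i for some i outside K x, then the inner product contains the
    vanishing factor of b_(x_i) with a_(x_i). *)
Lemma bfly_dot0 (R : comNzRingType) x y :
  flip y \notin cylinder x (~: K x) -> bfly_dot R x y = 0.
Proof.
rewrite inE => /forall_inPn[i]; rewrite inE => iK; rewrite ffunE => yxi.
have {}yxi : y i = x i by case: (y i) (x i) yxi => [] [].
rewrite /bfly_dot; under eq_bigr do rewrite -big_split /=.
rewrite -(bigA_distr_bigA (fun i b => factor R x i b * avec R (y i) b)).
rewrite (bigD1 i) //= /factor (negPf iK) yxi.
by under eq_bigr do rewrite mulrC; rewrite abvec_orth mul0r.
Qed.

(** Expanding only the second vector in the basis of the [avecs] writes the Gram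
    matrix as a product over y of factors that vanish unless flip y agrees with
    x off K x, respectively y agrees with x' on K x'. *)
Lemma butterfly_dot (R : comNzRingType) x y :
  \sum_z butterfly R x z * butterfly R y z =
  \sum_z bfly_dot R x z * bfly_coef R y z.
Proof.
under eq_bigr do rewrite (butterfly_avecs _ y) mulr_sumr.
rewrite exchange_big; apply: eq_bigr => z _.
by rewrite mulr_suml; apply: eq_bigr => t _; rewrite mulrA mulrAC.
Qed.

(** Modulo 2 the factor for x_i = 1 is (1, 1), whatever K x is. As a polynomial
    over F_2 in z, the vector of x is therefore the product of z_i + [i in K x]
    over the zeros i of x. Its leading monomial is indexed by the set of these
    zeros, and distinct x have distinct leading monomials. The proof extracts
    the coefficient of the leading monomial of x by summing over the z that are
    supported on the zeros of x. *)
Lemma butterfly_free2 (c : config n -> 'F_2) :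
  (forall z, \sum_x c x * butterfly 'F_2 x z = 0) -> forall x, c x = 0.
Proof.
move=> c0 x0; apply/eqP/negPn/negP => cx0.
pose Z x := [set i | ~~ x i].
case: (@arg_maxnP _ x0 (fun x => c x != 0) (fun x => #|Z x|) cx0) => x cx xmax.
(* The tensor with factors t is the indicator function of the z supported on Z x,
   so that T y is the coefficient of the monomial Z x in the vector of y. *)
pose t (i : 'I_n) (b : bool) : 'F_2 := if x i then (~~ b)%:R else 1.
pose T y := \sum_(z : config n) (\prod_i t i (z i)) * butterfly 'F_2 y z.
have TE y : T y = \prod_i \sum_b t i b * factor 'F_2 y i b.
  rewrite bigA_distr_bigA; apply: eq_bigr => z _.
  by rewrite -big_split.
have ch2 : 1 + 1 = 0 :> 'F_2 by apply/val_inj.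
have Txx : T x = 1.
  rewrite TE big1 // => i _; rewrite big_bool /t /factor /avec /bvec.
  by case: (x i); case: ifP => _; apply/val_inj.
have T0 y : ~~ (Z x \subset Z y) -> T y = 0.
  case/subsetPn=> i; rewrite !inE negbK => xi yi.
  rewrite TE (bigD1 i) //= big_bool /t /factor /avec /bvec (negPf xi) yi /=.
  by case: ifP => _; rewrite ?expr1 ?expr0 !mul1r ?ch2 ?addNr mul0r.
have: \sum_y c y * T y = 0.
  under eq_bigr do rewrite mulr_sumr.
  rewrite exchange_big big1 // => z _.
  under eq_bigr do rewrite mulrCA.
  by rewrite -mulr_sumr c0 mulr0.
rewrite (bigD1 x) //= Txx mulr1 big1 ?addr0; first by apply/eqP.
move=> y yx; have [->|cy] := eqVneq (c y) 0; first by rewrite mul0r.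
rewrite T0 ?mulr0 //; apply: contra yx => sxy.
have /eqP eZ : Z x == Z y by rewrite eqEcard sxy; apply: xmax.
apply/eqP/ffunP => i; have /setP/(_ i) := esym eZ; rewrite !inE.
by case: (y i) (x i) => [] [].
Qed.

Lemma butterfly_morph (R S : comNzRingType) (f : {rmorphism R -> S}) x z :
  f (butterfly R x z) = butterfly S x z.
Proof.
rewrite /butterfly rmorph_prod; apply: eq_bigr => i _.
by rewrite /factor /avec /bvec; case: ifP => _; case: (x i);
  rewrite ?rmorph1 ?rmorph_nat ?rmorph_sign.
Qed.

Definition bfly_mx (R : comNzRingType) : 'M[R]_#|config n| :=
  \matrix_(i, j) butterfly R (enum_val i) (enum_val j).

Lemma bfly_mx_morph (R S : comNzRingType) (f : {rmorphism R -> S}) :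
  map_mx f (bfly_mx R) = bfly_mx S.
Proof. by apply/matrixP => i j; rewrite !mxE butterfly_morph. Qed.

(** The matrix is integral and has an odd determinant by [butterfly_free2]; hence
    the determinant is nonzero in characteristic 0 as well. *)
Lemma bfly_mx_free : row_free (bfly_mx rat).
Proof.
rewrite row_free_unit unitmxE unitfE -(bfly_mx_morph (intr : int -> rat)) det_map_mx intr_eq0.
have: bfly_mx 'F_2 \in unitmx.
  rewrite -row_free_unit; apply/inj_row_free => v v0.
  pose c x := v 0 (enum_rank x).
  have c0 : forall x, c x = 0.
    apply: butterfly_free2 => z.
    have /matrixP/(_ 0 (enum_rank z)) := v0; rewrite !mxE => v0z; rewrite -[RHS]v0z.
    rewrite [LHS](reindex (@enum_val (config n) predT)); last first.
      exact/onW_bij/enum_val_bij.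
    by apply: eq_bigr => i _; rewrite /c mxE enum_valK enum_rankK.
  by apply/rowP => j; rewrite mxE -(enum_valK j); exact: c0.
rewrite unitmxE unitfE -(bfly_mx_morph (intr : int -> 'F_2)) det_map_mx.
by apply: contra => /eqP->; rewrite rmorph0.
Qed.

(** Reimer's butterfly theorem. The Gram matrix of the vectors of X is
    nonsingular, so it has rank #|X|. By [butterfly_dot] it is a product whose
    inner index y can be confined to Z: a nonzero term has y in a cylinder
    contained in A and flip y in a cylinder contained in B. *)
Theorem butterfly_card (X A B : {set config n}) :
  (forall x, x \in X -> cylinder x (K x) \subset A) ->
  (forall x, x \in X -> cylinder x (~: K x) \subset B) ->
  (#|X| <= #|[set z in A | flip z \in B]|)%N.
Proof.
move=> KA KB; set Z := [set z in A | _].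
pose f (i : 'I_#|X|) := enum_rank (enum_val i : config n).
have f_inj : injective f by move=> i j /enum_rank_inj/enum_val_inj.
pose S := rowsub f (bfly_mx rat).
have freeS : row_free S.
  have /row_freeP[T MT] := bfly_mx_free; apply/row_freeP.
  exists (colsub f T); rewrite /S mul_rowsub_mx mulmx_colsub MT.
  by apply/matrixP => i j; rewrite !mxE (inj_eq f_inj).
pose E : 'M[rat]_(#|X|, #|Z|) :=
  \matrix_(i, j) bfly_dot rat (enum_val i) (enum_val j).
pose C : 'M[rat]_(#|X|, #|Z|) :=
  \matrix_(i, j) bfly_coef rat (enum_val i) (enum_val j).
have gramE : S *m S^T = E *m C^T.
  apply/matrixP => i j; rewrite !mxE.
  transitivity (\sum_z butterfly rat (enum_val i) z * butterfly rat (enum_val j) z).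
    rewrite [RHS](reindex (@enum_val (config n) predT)); last exact/onW_bij/enum_val_bij.
    by apply: eq_bigr => k _; rewrite !mxE !enum_rankK.
  rewrite butterfly_dot (bigID (mem Z)) /= [X in _ + X]big1 ?addr0.
    by rewrite big_enum_val; apply: eq_bigr => k _; rewrite !mxE.
  move=> z zZ; have [zA|zA] := boolP (z \in A).
    rewrite bfly_dot0 ?mul0r //; apply: contra zZ => zK.
    by rewrite inE zA (subsetP (KB _ (enum_valP i))).
  rewrite bfly_coef0 ?mulr0 //; apply: contra zA.
  exact/subsetP/KA/enum_valP.
have := gram_free freeS; rewrite gramE /row_free => /eqP <-.
exact: leq_trans (mxrankM_maxl _ _) (rank_leq_col _).
Qed.
End Butterfly.

(** The two disjoint witnesses of a configuration in the box may be enlarged to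
    complementary ones, as the cylinders only shrink. *)
Theorem reimer n (A B : {set config n}) :
  (#|box A B| <= #|[set z in A | flip z \in B]|)%N.
Proof.
pose ok x (K : {set 'I_n}) := (cylinder x K \subset A) && (cylinder x (~: K) \subset B).
pose K x := odflt set0 [pick K | ok x K].
have okK x : x \in box A B -> ok x (K x).
  rewrite inE => /existsP[K0 /existsP[L /and3P[dKL KA LB]]].
  rewrite /K; case: pickP => //= /(_ K0); rewrite /ok KA /= => /negP[].
  apply: subset_trans LB; apply/subsetP => y; rewrite !inE => /forall_inP yL.
  apply/forall_inP => i iL; apply: yL; rewrite inE.
  by apply/negP => iK; move/pred0P: dKL => /(_ i); rewrite /= iK iL.
by apply: (@butterfly_card n K) => x /okK/andP[].
Qed.

(** * Increasing events under the k-out-of-n measure *)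

(** Disjoint occurrence pulls back along Phi when each coordinate of Phi w depends
    on one coordinate of w only, and different ones of Phi w depend on different
    coordinates. The second condition is asked of the ones of Phi w only, because
    for increasing events the witnesses may be shrunk to their ones. *)
Lemma box_preim m n (Phi : config m -> config n) (rep : 'I_n -> 'I_m)
    (A B : {set config n}) (w : config m) :
  increasing A -> increasing B ->
  (forall (w' : config m) i, w' (rep i) = w (rep i) -> Phi w' i = Phi w i) ->
  (forall i j, Phi w i -> Phi w j -> rep i = rep j -> i = j) ->
  Phi w \in box A B -> w \in box (Phi @^-1: A) (Phi @^-1: B).
Proof.
move=> incA incB loc one; rewrite !inE.
case/existsP=> K /existsP[L /and3P[dKL KA LB]].
have sub (D : {set config n}) (S : {set 'I_n}) : increasing D ->
    cylinder (Phi w) S \subset D ->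
    cylinder w [set rep i | i in [set i in S | Phi w i]] \subset Phi @^-1: D.
  move=> incD SD; apply/subsetP => w'; rewrite !inE => /forall_inP agr.
  (* g agrees with Phi w on S, hence lies in D, and is below Phi w'. *)
  pose g : config n := [ffun i => (i \in S) && Phi w i].
  apply: (incD g).
    apply: (subsetP SD); rewrite inE; apply/forall_inP => i iS.
    by rewrite ffunE iS.
  move=> i; rewrite ffunE; case: (boolP (_ && _)) => //= /andP[iS wi].
  by rewrite (loc w' i) ?wi //; apply/eqP/agr/imset_f; rewrite inE iS.
apply/existsP; exists [set rep i | i in [set i in K | Phi w i]].
apply/existsP; exists [set rep i | i in [set i in L | Phi w i]].
rewrite !sub // !andbT; apply/pred0P => l; apply/negP => /=.
case/andP=> /imsetP[i]; rewrite inE => /andP[iK wi] -> {l} /imsetP[j].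
rewrite inE => /andP[jL wj] /(one _ _ wi wj) ij.
by move/pred0P: dKL => /(_ i); rewrite /= iK ij jL.
Qed.

(** The coordinates where only a is 1 are matched with those where only b is 1,
    in the order in which they are enumerated. *)
Lemma swap_involution n (a b : config n) :
  #|[set i | a i]| = #|[set i | b i]| ->
  exists s : 'I_n -> 'I_n, [/\ involutive s, forall i, b i = a (s i) &
    forall i, s i != i -> a i != b i].
Proof.
move=> eq_ab; pose D (x y : config n) := [set i | x i] :\: [set i | y i].
have eqD : #|D a b| = #|D b a| by rewrite !cardsD eq_ab setIC.
have inD x y i : (i \in D x y) = x i && ~~ y i by rewrite !inE andbC.
pose h (X Y : {set 'I_n}) i := nth i (enum Y) (index i (enum X)).
have hP (X Y : {set 'I_n}) i : #|X| = #|Y| -> i \in X -> h X Y i \in Y /\ h Y X (h X Y i) = i.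
  move=> eXY iX; have lt : (index i (enum X) < size (enum Y))%N.
    by rewrite -cardE -eXY cardE index_mem mem_enum.
  have hY : h X Y i \in Y by rewrite -mem_enum mem_nth.
  split=> //; rewrite /h index_uniq ?enum_uniq //.
  by rewrite nth_index // mem_enum.
pose s i := if i \in D a b then h (D a b) (D b a) i
            else if i \in D b a then h (D b a) (D a b) i else i.
have sD i : [\/ [/\ i \in D a b, s i \in D b a & s (s i) = i],
    [/\ i \in D b a, s i \in D a b & s (s i) = i] |
    [/\ a i = b i & s i = i]].
  case: (boolP (i \in D a b)) => iab.
    constructor 1; have [hi hh] := hP _ _ _ eqD iab.
    have si : s i = h (D a b) (D b a) i by rewrite /s iab.
    rewrite si; split=> //; rewrite /s hi.
    by case: ifP hi => //; rewrite !inD => /andP[-> _] /andP[_].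
  case: (boolP (i \in D b a)) => iba.
    constructor 2; have [hi hh] := hP _ _ _ (esym eqD) iba.
    have si : s i = h (D b a) (D a b) i by rewrite /s (negPf iab) iba.
    by rewrite si; split=> //; rewrite /s hi.
  constructor 3; split; last by rewrite /s (negPf iab) (negPf iba).
  by move: iab iba; rewrite !inD; case: (a i) (b i) => [] [].
exists s; split=> [i|i|i]; case: (sD i); rewrite ?inD.
- by case.
- by case.
- by case=> _ si; rewrite !si.
- by case=> /andP[_ /negPf->] /andP[_ /negPf->].
- by case=> /andP[-> _] /andP[-> _].
- by case=> ab si; rewrite si ab.
- by case=> /andP[-> /negPf->].
- by case=> /andP[-> /negPf->].
- by case=> _ ->; rewrite eqxx.
Qed.

Definition permute n (p : 'S_n) (a : config n) : config n := [ffun i => a (p i)].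

(** Each pair {i, s i} exchanged by the involution of [swap_involution] carries
    exactly one 1 of a. The permutations r w below, one for each subset of the
    set of pairs, move some of these 1s to the partner coordinate, and the
    opposite choice corresponds to the same motion applied to b. For fixed p,
    Reimer's theorem on the cube of choices compares the two sides with p
    replaced by p * r w, summed over w. As p ranges over the whole symmetric
    group, multiplying by r w changes nothing, so this average is the claim. *)
Lemma swap_average n (a b : config n) (A B : {set config n}) :
  increasing A -> increasing B ->
  #|[set i | a i]| = #|[set i | b i]| ->
  (\sum_(p : 'S_n) (permute p a \in box A B) <=
   \sum_(p : 'S_n) ((permute p a \in A) && (permute p b \in B)))%N.
Proof.
move=> incA incB /swap_involution[s [sK bE sab]].
(* The coordinate w (rep i), common to both members of a pair, tells whether the
   pair is exchanged; it sits at the member where a is 1. *)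
pose rep i := if a i then i else s i.
have rep_s i : rep (s i) = rep i.
  have [-> //|/sab] := eqVneq (s i) i.
  by rewrite /rep sK bE; case: (a i) (a (s i)) => [] [].
pose rho (w : config n) i := if w (rep i) then s i else i.
have rhoK w : involutive (rho w).
  by move=> i; rewrite /rho; case wi: (w (rep i)); rewrite /= ?rep_s wi ?sK.
pose r w : 'S_n := perm (can_inj (rhoK w)).
pose Phi p w := permute (p * r w)%g a.
have PhiE p w i : Phi p w i = a (rho w (p i)) by rewrite ffunE permM permE.
have Phi_flip p w : Phi p (flip w) = permute (p * r w)%g b.
  apply/ffunP => i; rewrite PhiE ffunE permM permE bE /rho ffunE.
  by case: (w _) => //=; rewrite sK.
have cfg_gt0 : (0 < #|config n|)%N by apply/card_gt0P; exists a.
have avg (F : 'S_n -> nat) :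
    (\sum_p \sum_w F (p * r w)%g = #|config n| * \sum_p F p)%N.
  rewrite exchange_big -sum_nat_const; apply: eq_big => // w _.
  by rewrite [RHS](reindex_inj (mulIg (r w))).
rewrite -(leq_pmul2l cfg_gt0) -!avg; apply: leq_sum => p _.
have card_sum (Q : pred (config n)) : (\sum_w (Q w : nat) = #|[set w | Q w]|)%N.
  by rewrite -sum1dep_card [RHS]big_mkcond; apply: eq_bigr => w _; case: (Q w).
rewrite !card_sum; apply: leq_trans (_ : #|box (Phi p @^-1: A) (Phi p @^-1: B)| <= _)%N.
  apply/subset_leq_card/subsetP => w; rewrite inE.
  apply: (@box_preim _ _ (Phi p) (fun i => rep (p i))) => // [w' i|i j].
    by rewrite !PhiE /rho => ->.
  rewrite !PhiE => ai aj rij; apply: (@perm_inj _ p); apply/eqP/negPn/negP => pij.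
  (* Two coordinates with the same rep are equal or partners; partners cannot
     both carry a 1 of Phi p w. *)
  have pjE : p j = s (p i).
    move: rij pij; rewrite /rep; case: ifP => _; case: ifP => _.
    - by move->; rewrite eqxx.
    - by move->; rewrite sK.
    - by move->.
    - by move/(can_inj sK)->; rewrite eqxx.
  have /sab : s (rho w (p i)) != rho w (p i).
    rewrite /rho; case: ifP => _; rewrite ?sK -pjE //.
    by rewrite eq_sym.
  rewrite ai bE; move: aj; rewrite pjE /rho rep_s; case: ifP => _.
    by rewrite sK => ->.
  by move=> ->.
apply: leq_trans (reimer _ _) _; apply/subset_leq_card/subsetP => w.
by rewrite !inE Phi_flip.
Qed.

Lemma permute_inj n (p : 'S_n) : injective (permute p).
Proof.
move=> a b /ffunP ab; apply/ffunP => i.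
by have := ab (p^-1%g i); rewrite !ffunE permKV.
Qed.

Lemma permute_Omega n k (p : 'S_n) a : (permute p a \in Omega k n) = (a \in Omega k n).
Proof.
rewrite !inE -(card_imset [set i | permute p a i] (@perm_inj _ p)).
suff -> : [set p i | i in [set i | permute p a i]] = [set i | a i] by [].
apply/setP => i; rewrite inE -{1}(permKV p i) mem_imset ?inE ?ffunE ?permKV //.
exact: perm_inj.
Qed.

(** [swap_average] summed over all pairs of configurations with k ones: each
    permutation preserves this set, so that each contributes equally. *)
Lemma box_Omega n k (A B : {set config n}) :
  increasing A -> increasing B ->
  (#|Omega k n| * #|Omega k n :&: box A B| <=
   #|Omega k n :&: A| * #|Omega k n :&: B|)%N.
Proof.
move=> incA incB; set O := Omega k n.
have perm_sum (p : 'S_n) (F : config n -> nat) :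
    (\sum_(a in O) F (permute p a) = \sum_(a in O) F a)%N.
  rewrite [RHS](reindex_inj (@permute_inj n p)).
  by apply: eq_bigl => a; rewrite permute_Omega.
have card_sum (D : {set config n}) : (\sum_(a in O) (a \in D) = #|O :&: D|)%N.
  rewrite -sum1_card [LHS]big_mkcond [RHS]big_mkcond; apply: eq_bigr => a _.
  by rewrite in_setI; case: (a \in O); case: (a \in D).
have Sn_gt0 : (0 < #|{: 'S_n}|)%N by apply/card_gt0P; exists 1%g.
have boxE : (\sum_(a in O) \sum_(b in O) \sum_(p : 'S_n) (permute p a \in box A B)
    = #|{: 'S_n}| * (#|O| * #|O :&: box A B|))%N.
  under eq_bigr do rewrite sum_nat_const.
  rewrite -big_distrr /= exchange_big mulnCA; congr (_ * _)%N.
  under eq_bigr do rewrite (perm_sum _ (fun a => (a \in box A B) : nat)) card_sum.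
  by rewrite sum_nat_const.
have prodE : (\sum_(a in O) \sum_(b in O) \sum_(p : 'S_n)
      ((permute p a \in A) && (permute p b \in B))
    = #|{: 'S_n}| * (#|O :&: A| * #|O :&: B|))%N.
  under eq_bigr do rewrite exchange_big.
  rewrite exchange_big -[RHS]sum_nat_const; apply: eq_big => // p _.
  under eq_bigr do under eq_bigr do rewrite -mulnb.
  under eq_bigr do rewrite -big_distrr /=
    (perm_sum _ (fun a => (a \in B) : nat)) card_sum.
  by rewrite -big_distrl /= (perm_sum _ (fun a => (a \in A) : nat)) card_sum.
rewrite -(leq_pmul2l Sn_gt0) -boxE -prodE.
apply: leq_sum => a; rewrite inE => /eqP aO; apply: leq_sum => b.
by rewrite inE => /eqP bO; apply: swap_average; rewrite ?aO ?bO.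
Qed.

Lemma P_card (R : realFieldType) n k (A : {set config n}) :
  P R k A = #|Omega k n :&: A|%:R / #|Omega k n|%:R.
Proof.
rewrite /P /kn_mass -big_mkcondr /=.
rewrite (eq_bigl (mem (Omega k n :&: A))); last by move=> w; rewrite !inE andbC.
by rewrite sumr_const mulr_natl.
Qed.

Theorem theorem1p2 (R : realFieldType) (n k : nat) (A B : {set config n})
    (n_gt0 : (0 < n)%N) (k_le_n : (k <= n)%N)
    (incA : increasing A) (incB : increasing B) :
  P R k (box A B) <= P R k A * P R k B.
Proof.
rewrite !P_card; have [->|O0] := eqVneq #|Omega k n| 0%N.
  by rewrite invr0 !mulr0.
have Opos : 0 < #|Omega k n|%:R :> R by rewrite ltr0n lt0n.
rewrite mulrACA -invfM ler_pdivlMr ?mulr_gt0 // mulrA divfK ?gt_eqF //.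
by rewrite mulrC -!natrM ler_nat box_Omega.
Qed.
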